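(* Let $n \ge k \ge 2$ be integers. If $n$ is even, then $$\frac{n-2}{k-1}+\frac{n}{2(k-1)^2} \le A_p(n,k) \le A_c(n,k) \le \Big\lceil \frac{n-1}{k-1} \Big\rceil+\Big\lceil \frac{n-1}{(k-1)^2}\Big\rceil.$$ If $n$ is odd, then $$\frac{n-5}{k-1}+\frac{n-k}{2(k-1)^2}\le A_p(n,k) \le A_c(n,k) \le \Big\lceil \frac{n-1}{k-1} \Big\rceil + \Big\lceil\frac{n-1}{(k-1)^2}\Big\rceil.$$
   Context: Consider the following adaptive search game between Questioner and Adversary. There are $n$ balls labelled $1,\dots,n$, each colored with one of three colors; the coloring is unknown to Questioner. A query is a $k$-element subset of the balls, chosen adaptively (it may depend on previous answers). The answer to a query is the partition of the queried set into color classes (i.e. which queried balls have the same color as each other), without revealing which color each class has. Adversary may answer arbitrarily as long as there always exists a 3-coloring of all $n$ balls consistent with all answers given so far. A plurality ball is a ball whose color class is strictly larger than every other color class. In the Plurality problem, Questioner must either exhibit a plurality ball or correctly state that none exists, i.e. the answers must determine this for every consistent coloring. $A_p(n,k)$ denotes the number of queries needed in the worst case when both players play optimally (minimum over Questioner strategies of the maximum over Adversary strategies of the number of queries). $A_c(n,k)$ is defined in the same way for the Partition problem, where Questioner's goal is to determine the partition of the balls into color classes (up to permutation of the colors). *)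

(* Defs.v *)
From HB Require Import structures.
From mathcomp Require Import all_boot all_order all_algebra.
From mathcomp Require Import boolp.

Set Implicit Arguments.
Unset Strict Implicit.
Unset Printing Implicit Defensive.

Section Game.
Variables n k : nat.

Definition coloring := {ffun 'I_n -> 'I_3}.

(* The color of ball [b] has strictly more balls than any other color; colors
   that are not used have an empty class, which is harmless since the class of
   [b] is nonempty. *)
Definition plurality_ball (c : coloring) (b : 'I_n) : Prop :=
  forall d : 'I_3, d != c b -> #|[set i | c i == d]| < #|[set i | c i == c b]|.

Definition query := {set 'I_n}.
Definition answer := {set {set 'I_n}}.

(* The queries asked so far with the answers received, oldest first. *)
Definition history := seq (query * answer).

Definition true_answer (c : coloring) (Q : query) : answer :=
  preim_partition c Q.

Definition consistent (c : coloring) (h : history) : Prop :=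
  forall qa, qa \in h -> qa.2 = true_answer c qa.1.

Definition solved_plurality (h : history) : Prop :=
  (exists b, forall c, consistent c h -> plurality_ball c b) \/
  (forall c, consistent c h -> ~ exists b, plurality_ball c b).

Definition solved_partition (h : history) : Prop :=
  exists P : answer,
    forall c, consistent c h -> preim_partition c [set: 'I_n] = P.

Definition questioner := history -> query.
Definition adversary := history -> query -> answer.

Definition legal_questioner (q : questioner) : Prop := forall h, #|q h| = k.

(* After a reply there must still be a coloring that explains everything. *)
Definition legal_adversary (a : adversary) : Prop :=
  forall (h : history) (Q : query), #|Q| = k ->
    (exists c, consistent c h) -> exists c, consistent c (rcons h (Q, a h Q)).

Fixpoint play (q : questioner) (a : adversary) (m : nat) : history :=
  if m is m'.+1 then
    let h := play q a m' in rcons h (q h, a h (q h))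
  else [::].

Definition ends_within (solved : history -> Prop) (q : questioner)
    (a : adversary) (m : nat) : Prop :=
  exists2 j, j <= m & solved (play q a j).

Definition can_force (solved : history -> Prop) (m : nat) : Prop :=
  exists2 q, legal_questioner q &
    forall a, legal_adversary a -> ends_within solved q a m.

(* The minimum over Questioner of the maximum over Adversary of the number of
   queries, with junk value 0 if no number of queries suffices; see
   [can_force_plurality] and [can_force_partition]. *)
Definition game_value (solved : history -> Prop) : nat :=
  match pselect (exists m, `[< can_force solved m >]) with
  | left ex => ex_minn ex
  | right _ => 0
  end.

End Game.

Definition A_p (n k : nat) : nat := game_value k (@solved_plurality n).
Definition A_c (n k : nat) : nat := game_value k (@solved_partition n).

Section Termination.
Variables n k : nat.
Hypotheses (k_ge2 : 2 <= k) (k_le_n : k <= n).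

Let ksets : seq {set 'I_n} := enum [set Q : {set 'I_n} | #|Q| == k].

Lemma ksets_cover (i j : 'I_n) :
  exists Q : {set 'I_n}, [/\ #|Q| = k, i \in Q & j \in Q].
Proof.
have h2 : #|[set i; j]| <= k.
  by apply: leq_trans k_ge2; rewrite cards2; case: (i != j).
have h : k - #|[set i; j]| <= #|~: [set i; j]|.
  by rewrite (cardsCs (~: _)) setCK card_ord leq_sub2r.
have [B [sB cB]] : exists B : {set 'I_n}, B \subset ~: [set i; j] /\
    #|B| = k - #|[set i; j]|.
  exists [set x in take (k - #|[set i; j]|) (enum (~: [set i; j]))]; split.
    apply/subsetP=> x; rewrite inE => /mem_take.
    by rewrite mem_enum.
  rewrite cardsE (card_uniqP _) ?take_uniq ?enum_uniq // size_takel //.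
  by rewrite -cardE.
exists ([set i; j] :|: B); rewrite !inE !eqxx ?orbT; split=> //.
rewrite cardsU (_ : _ :&: B = set0) ?cards0 ?subn0 ?cB ?subnKC //.
by apply/eqP; rewrite setIC setI_eq0 disjoints_subset.
Qed.

Definition ask_all : questioner n := fun h =>
  nth (odflt set0 (ohead ksets)) ksets (size h).

Lemma ask_all_legal : legal_questioner k ask_all.
Proof.
have inP Q : Q \in ksets -> #|Q| = k by rewrite mem_enum inE => /eqP.
move=> h.
have [i0 _] : exists i : 'I_n, true.
  by exists (Ordinal (leq_trans (ltnW k_ge2) k_le_n)).
have [Q [cQ _ _]] := ksets_cover i0 i0.
have ksQ : Q \in ksets by rewrite mem_enum inE cQ.
have head_in (s : seq {set 'I_n}) : Q \in s -> odflt set0 (ohead s) \in s.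
  by case: s => [|Q0 s] _ //=; rewrite mem_head.
apply: inP; rewrite /ask_all.
have [hs|hs] := ltnP (size h) (size ksets); first exact: mem_nth.
by rewrite nth_default //; apply: head_in.
Qed.

Lemma size_play (q : questioner n) a m : size (play q a m) = m.
Proof. by elim: m => //= m IHm; rewrite size_rcons IHm. Qed.

Lemma ask_all_asks a m Q : Q \in take m ksets ->
  exists R, (Q, R) \in play ask_all a m.
Proof.
elim: m => [|m IHm] /=; first by rewrite take0.
case: (ltnP m (size ksets)) => hm; last first.
  rewrite take_oversize ?(leqW hm) // => hQ.
  have [|R hR] := IHm; first by rewrite take_oversize.
  by exists R; rewrite mem_rcons inE hR orbT.
set h := play ask_all a m in IHm *.
have ask_h : ask_all h = nth (odflt set0 (ohead ksets)) ksets m.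
  by rewrite /ask_all size_play.
rewrite (take_nth (odflt set0 (ohead ksets))) // mem_rcons inE -ask_h.
case/orP=> [/eqP->|/IHm[R hR]].
  by exists (a h (ask_all h)); rewrite mem_rcons mem_head.
by exists R; rewrite mem_rcons inE hR orbT.
Qed.

Lemma ask_all_kernel a c c' :
  consistent c (play ask_all a (size ksets)) ->
  consistent c' (play ask_all a (size ksets)) ->
  forall i j, (c i == c j) = (c' i == c' j).
Proof.
move=> hc hc' i j; have [Q [cQ iQ jQ]] := ksets_cover i j.
have [|R hR] := @ask_all_asks a (size ksets) Q.
  by rewrite take_size mem_enum inE cQ.
have E : preim_partition c Q = preim_partition c' Q.
  by rewrite -[LHS](hc _ hR) -[RHS](hc' _ hR).
have eqR (d : coloring n) : {in Q & &, equivalence_rel [rel x y | d x == d y]}.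
  by split=> //= /eqP->.
by rewrite -[LHS](pblock_equivalence_partition (eqR c) iQ jQ)
  -[RHS](pblock_equivalence_partition (eqR c') iQ jQ) -/(preim_partition c Q) E.
Qed.

Lemma can_force_partition : exists m, can_force k (@solved_partition n) m.
Proof.
exists (size ksets), ask_all; first exact: ask_all_legal.
move=> a _; exists (size ksets) => //.
have [[c hc]|no] := pselect (exists c, consistent c (play ask_all a (size ksets))).
  exists (preim_partition c setT) => c' hc'.
  apply: eq_imset => x; apply/setP => y; rewrite !inE /=.
  exact: (ask_all_kernel hc' hc).
by exists set0 => c hc; case: no; exists c.
Qed.

Lemma plurality_kernel (c c' : coloring n) b :
  (forall i j, (c i == c j) = (c' i == c' j)) ->
  plurality_ball c b -> plurality_ball c' b.
Proof.
move=> E hb d hd.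
have cl i : #|[set j | c' j == c' i]| = #|[set j | c j == c i]|.
  by congr #|pred_of_set _|; apply/setP => j; rewrite !inE E.
have [/existsP[i /eqP hi]|] := boolP [exists i, c' i == d].
  by rewrite -hi !cl hb // E hi.
rewrite negb_exists => /forallP no.
rewrite (_ : [set i | c' i == d] = set0) ?cards0; last first.
  by apply/setP => i; rewrite !inE (negbTE (no i)).
by apply/card_gt0P; exists b; rewrite inE.
Qed.

Lemma can_force_plurality : exists m, can_force k (@solved_plurality n) m.
Proof.
exists (size ksets), ask_all; first exact: ask_all_legal.
move=> a _; exists (size ksets) => //.
have [[c [hc [b hb]]]|no] := pselect (exists c,
  consistent c (play ask_all a (size ksets)) /\ exists b, plurality_ball c b).
  left; exists b => c' hc'.
  exact: plurality_kernel (ask_all_kernel hc hc') hb.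
by right=> c hc hb; case: no; exists c.
Qed.

End Termination.

(* Main.v *)
(** Upper bound: every query of the first round contains a fixed ball [x], so
    the color class of [x] becomes known.  From each of these queries take one
    representative not colored like [x] (if there is one).  Only two colors
    remain, so comparing all representatives with a single one of them, [k - 1]
    at a time, determines the whole partition.

    Lower bound: Adversary keeps a coloring with classes of sizes [s, s, e],
    where [s = n./2] and [e = odd n], and tells apart colors 0 and 1 in every
    query with a fresh ball until one of these classes is used up; this takes
    about [s / (k - 1)] two-colored queries.  When Questioner stops, nothing
    consistent has a plurality, so that a set of balls of color 0 (or 1) closed
    under the answers can be given color 2 only if its size is [s - e].  Hence
    the query traces on color class 0 plus the ball of color 2 form at most
    [1 + e] components, and likewise for color 1.  A query of [k] balls lowers
    the two component counts by at most [k - 1] in total, and by one less if it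
    is two-colored; summing over the queries gives the bound. *)

Require Import Defs.
From mathcomp Require Import all_boot all_order all_algebra.
From mathcomp Require Import perm boolp archimedean.
From mathcomp Require Import zify lra ring.

Set Implicit Arguments.
Unset Strict Implicit.
Unset Printing Implicit Defensive.

(** * Answers as color kernels, and the value of the game *)

Lemma true_answerP (n : nat) (c c' : coloring n) (Q : query n) :
  true_answer c Q = true_answer c' Q <->
  {in Q &, forall i j, (c i == c j) = (c' i == c' j)}.
Proof.
split=> [E i j iQ jQ | E].
  have eqR (d : coloring n) :
      {in Q & &, equivalence_rel [rel x y | d x == d y]}.
    by split=> //= /eqP->.
  by rewrite -[LHS](pblock_equivalence_partition (eqR c) iQ jQ)
    -[RHS](pblock_equivalence_partition (eqR c') iQ jQ)
    -/(preim_partition c Q) -/(true_answer c Q) E.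
apply: eq_in_imset => i iQ; apply/setP => j; rewrite !inE /=.
by case jQ: (j \in Q) => //=; apply: E.
Qed.

Lemma consistent_eqker (n : nat) (c c' : coloring n) (h : history n) :
  consistent c h ->
  (forall qa, qa \in h ->
     {in qa.1 &, forall i j, (c i == c j) = (c' i == c' j)}) ->
  consistent c' h.
Proof. by move=> hc E qa qah; rewrite hc //; apply/true_answerP/E. Qed.

Lemma consistent_rcons (n : nat) (c : coloring n) (h : history n) Q R :
  consistent c (rcons h (Q, R)) <-> consistent c h /\ R = true_answer c Q.
Proof.
split=> [hc | [hc ->] qa].
  split=> [qa qah|]; first by apply: hc; rewrite mem_rcons inE qah orbT.
  by apply: (hc (Q, R)); rewrite mem_rcons mem_head.
by rewrite mem_rcons inE => /predU1P[-> //|]; apply: hc.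
Qed.

Lemma solved_partition_plurality (n : nat) (h : history n) :
  solved_partition h -> solved_plurality h.
Proof.
case=> P hP.
have [[c [hc [b hb]]]|no] := pselect (exists c,
  consistent c h /\ exists b, plurality_ball c b); last first.
  by right=> c hc hb; case: no; exists c.
left; exists b => c' hc'; apply: plurality_kernel hb => i j.
have /true_answerP E : true_answer c setT = true_answer c' setT.
  by rewrite /true_answer !hP.
by apply: E; rewrite inE.
Qed.

Section GameValue.
Variables (n k : nat) (solved : history n -> Prop).

Lemma game_value_can_force m :
  can_force k solved m -> can_force k solved (game_value k solved).
Proof.
move=> hm; rewrite /game_value; case: pselect => [ex|]; last first.
  by case; exists m; apply/asboolP.
by case: ex_minnP => i /asboolP.
Qed.

Lemma game_value_le m : can_force k solved m -> game_value k solved <= m.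
Proof.
move=> hm; rewrite /game_value; case: pselect => [ex|//].
by case: ex_minnP => i _; apply; apply/asboolP.
Qed.

(* Off the invariant, legality is ensured by answering according to any
   coloring that explains the history. *)
Lemma can_force_inv (inv : history n -> Prop) (m : nat) :
    inv [::] ->
    (forall h (Q : query n), inv h -> #|Q| = k ->
      exists R, inv (rcons h (Q, R))) ->
    (forall h, inv h -> exists c, consistent c h) ->
  can_force k solved m -> exists h, [/\ inv h, solved h & size h <= m].
Proof.
move=> inv0 invS invC [q hq force].
pose ok (p : history n * query n) R :=
  (inv p.1 -> #|p.2| = k -> inv (rcons p.1 (p.2, R))) /\
  (~ inv p.1 -> (exists c, consistent c p.1) ->
    exists c, consistent c (rcons p.1 (p.2, R))).
have /choice[a ha] : forall p, exists R, ok p R.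
  move=> [h Q]; rewrite /ok /=.
  have [hi|no] := pselect (inv h).
    have [hQ|no] := pselect (#|Q| = k); last by exists set0; split.
    by have [R hR] := invS _ _ hi hQ; exists R; split.
  have [[c hc]|no'] := pselect (exists c, consistent c h).
    exists (true_answer c Q); split=> // _ _.
    by exists c; apply/consistent_rcons.
  by exists set0; split.
have [|j lejm sj] := force (fun h Q => a (h, Q)).
  move=> h Q hQ exc; have [h1 h2] := ha (h, Q).
  by have [/h1/(_ hQ)/invC|/h2/(_ exc)] := pselect (inv h).
exists (play q (fun h Q => a (h, Q)) j); rewrite size_play; split=> //.
by elim: j {lejm sj} => //= i IHi; apply: (ha (_, _)).1 => //=.
Qed.

End GameValue.

Lemma play_take (n : nat) (q : questioner n) a i j :
  i <= j -> take i (play q a j) = play q a i.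
Proof.
elim: j => [|j IHj]; first by rewrite leqn0 => /eqP->.
rewrite leq_eqVlt => /predU1P[->|lt_ij].
  by rewrite take_oversize ?size_play.
by rewrite /= -cats1 takel_cat ?size_play // IHj.
Qed.

(** * Upper bound: two rounds of star queries *)

Lemma star_cover (n k m : nat) (x : 'I_n) (D : {set 'I_n}) :
    0 < k <= n -> #|D :\ x| <= m * k.-1 ->
  exists S : seq (query n), [/\ size S = m,
    forall Q, Q \in S -> #|Q| = k /\ x \in Q
    & forall y, y \in D -> y != x -> exists2 Q, Q \in S & y \in Q].
Proof.
move=> /andP[k_gt0 k_le]; elim: m D => [|m IHm] D.
  rewrite mul0n leqn0 cards_eq0 => /eqP D0; exists [::]; split=> // y yD yx.
  by have := in_set0 y; rewrite -D0 !inE yD yx.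
(* [l] lists the balls still to be covered before all the others, so a query made of [x] and the
   first [k.-1] entries covers greedily and pads only after [B] is exhausted. *)
move=> cD; set B := D :\ x; set l := enum B ++ enum (~: (x |: B)).
have xB : x \notin B by rewrite !inE eqxx.
have l_uniq : uniq l.
  rewrite cat_uniq !enum_uniq /= andbT; apply/hasPn => y.
  by rewrite !mem_enum inE; apply: contraNN => yB; rewrite inE yB orbT.
have size_l : size l = n.-1.
  rewrite size_cat -!cardE; have := cardsC (x |: B).
  by rewrite cardsU1 xB card_ord add1n addSn => /(congr1 predn).
set Q := x |: [set y in take k.-1 l].
have cQ : #|Q| = k.
  have xl : x \notin take k.-1 l.
    by apply/negP => /mem_take; rewrite mem_cat !mem_enum !inE eqxx.
  rewrite cardsU1 inE xl cardsE (card_uniqP _) ?take_uniq // size_takel.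
    by rewrite add1n prednK.
  by rewrite size_l; move: k_gt0 k_le; clear; lia.
have [|S [sS SQ Scov]] := IHm (D :\: Q).
  have sub : {subset (D :\: Q) :\ x <= drop k.-1 (enum B)}.
    move=> y; rewrite !inE => /and3P[yx]; rewrite (negPf yx) /= => yl yD.
    have yB : y \in enum B by rewrite mem_enum !inE yx yD.
    move: yB; rewrite -[X in y \in X](cat_take_drop k.-1) mem_cat => /orP[|//] yt.
    case/negP: yl; rewrite take_cat; case: ifP => // _; rewrite mem_cat.
    by rewrite (mem_take yt).
  have : size (enum ((D :\: Q) :\ x)) <= size (drop k.-1 (enum B)).
    by apply: uniq_leq_size (enum_uniq _) _ => y; rewrite mem_enum; apply: sub.
  rewrite -cardE size_drop -cardE => /leq_trans; apply.
  by rewrite leq_subLR -mulSn.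
exists (Q :: S); split; first by rewrite /= sS.
  move=> Q'; rewrite inE => /predU1P[->|/SQ//]; split=> //.
  by rewrite !inE eqxx.
move=> y yD yx; have [yQ|yQ] := boolP (y \in Q).
  by exists Q => //; rewrite mem_head.
have [|Q' Q'S yQ'] := Scov y _ yx; first by rewrite inE yQ yD.
by exists Q' => //; rewrite inE Q'S orbT.
Qed.

(** With [t] excluded only two colors remain, so comparing both [u] and [v] with the single color
    [w] decides whether they are equal. *)
Lemma eq_color3 (t u v w : 'I_3) :
  u != t -> v != t -> w != t -> (u == v) = ((u == w) == (v == w)).
Proof.
by case: t u v w => [[|[|[]]]//?] [[|[|[]]]//?] [[|[|[]]]//?] [[|[|[]]]//?].
Qed.

Section Upper.
Variables (n k m m' : nat) (x : 'I_n).
Hypotheses (k_gt0 : 0 < k) (k_le_n : k <= n).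
Hypotheses (hm : n.-1 <= m * k.-1) (hm' : m <= m' * k.-1).

Let kpos : 0 < k <= n. Proof. by rewrite k_gt0. Qed.

(** Here [S] is the first round and [d] a coloring explaining its answers; [D] meets every query of
    [S] that is not entirely colored like the center [x]. *)
Definition representatives (S : seq (query n)) (d : coloring n)
    (D : {set 'I_n}) : Prop :=
  (forall r, r \in D -> d r != d x) /\
  (forall Q y, Q \in S -> y \in Q -> d y != d x ->
     exists2 r, r \in D & r \in Q).

Lemma exists_representatives (S : seq (query n)) (d : coloring n) :
  exists2 D : {set 'I_n}, #|D| <= size S & representatives S d D.
Proof.
(* The default [x] is discarded by the filter [d y != d x] in the witness below. *)
pose rep (Q : query n) := odflt x [pick y in Q | d y != d x].
exists [set y in [seq rep Q | Q <- S] | d y != d x].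
  apply: leq_trans (_ : #|[seq rep Q | Q <- S]| <= _).
    by apply: subset_leq_card; apply/subsetP => y; rewrite inE => /andP[].
  by rewrite -(size_map rep S) card_size.
split=> [r|Q y QS yQ dy]; first by rewrite inE => /andP[].
have repQ : (rep Q \in Q) && (d (rep Q) != d x).
  by rewrite /rep; case: pickP => [z //|/(_ y)]; rewrite yQ dy.
exists (rep Q); case/andP: repQ => // rQ dr.
by rewrite inE dr andbT map_f.
Qed.

Lemma comparison_queries (D : {set 'I_n}) : #|D| <= m ->
  exists t : seq (query n), [/\ size t = m', forall Q, Q \in t -> #|Q| = k
   & D = set0 \/ exists2 a, a \in D & forall r, r \in D -> r != a ->
       exists Q, [/\ Q \in t, a \in Q & r \in Q]].
Proof.
move=> cD; have [D0|[a aD]] := set_0Vmem D.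
  (* Nothing has to be compared, but the second round still needs [m'] legal queries; any star
     provides them. *)
  have [|t [st tQ _]] := @star_cover n k m' x set0 kpos.
    by rewrite set0D cards0.
  by exists t; split=> // [Q /tQ[]//|]; left.
have [|t [st tQ tcov]] := @star_cover n k m' a D kpos.
  by apply: leq_trans (subset_leq_card (subsetDl _ _)) (leq_trans cD hm').
exists t; split=> // [Q /tQ[]//|]; right; exists a => // r rD ra.
by have [Q Qt rQ] := tcov r rD ra; exists Q; split=> //; case: (tQ Q Qt).
Qed.

(** The first round fixes the class of [x]. A ball [y] outside it shares a query of [S] with a
    representative [r], and [r] shares a query of [t] with [a]; as only two colors are left, these
    two comparisons settle [y] against [a], hence any two balls against each other. *)
Lemma star_comparison_kernel (S t : seq (query n)) (d c c' : coloring n)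
    (D : {set 'I_n}) :
    (forall Q, Q \in S -> x \in Q) ->
    (forall y, y != x -> exists2 Q, Q \in S & y \in Q) ->
    representatives S d D ->
    D = set0 \/ (exists2 a, a \in D & forall r, r \in D -> r != a ->
       exists Q, [/\ Q \in t, a \in Q & r \in Q]) ->
    (forall Q, Q \in S ->
       {in Q &, forall i j, (c i == c j) = (d i == d j)}) ->
    (forall Q, Q \in S ->
       {in Q &, forall i j, (c i == c j) = (c' i == c' j)}) ->
    (forall Q, Q \in t ->
       {in Q &, forall i j, (c i == c j) = (c' i == c' j)}) ->
  forall i j, (c i == c j) = (c' i == c' j).
Proof.
move=> Sx Scov [Dx Drep] Dt cd cc' ct.
have cdx y : (c y == c x) = (d y == d x).
  have [->|/Scov[Q QS yQ]] := eqVneq y x; first by rewrite !eqxx.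
  by apply: (cd _ QS) => //; apply: Sx.
have ccx y : (c y == c x) = (c' y == c' x).
  have [->|/Scov[Q QS yQ]] := eqVneq y x; first by rewrite !eqxx.
  by apply: (cc' _ QS) => //; apply: Sx.
case: Dt => [D0|[a aD Da]].
  have cx y : c y == c x.
    have [->//|yx] := eqVneq y x; rewrite cdx; apply: contraT => dy.
    have [Q QS yQ] := Scov y yx; have [r] := Drep Q y QS yQ dy.
    by rewrite D0 inE.
  have c'x y : c' y == c' x by rewrite -ccx.
  by move=> i j; rewrite !(eqP (cx _)) !(eqP (c'x _)) !eqxx.
have Dcx r : r \in D -> c r != c x by move=> /Dx; rewrite cdx.
have cca y : c y != c x -> (c y == c a) = (c' y == c' a).
  move=> cy; have dy : d y != d x by rewrite -cdx.
  have yx : y != x by apply: contraNneq cy => ->.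
  have [Q QS yQ] := Scov y yx; have [r rD rQ] := Drep Q y QS yQ dy.
  have cr := Dcx r rD; have ca := Dcx a aD.
  have cra : (c r == c a) = (c' r == c' a).
    have [->|ra] := eqVneq r a; first by rewrite !eqxx.
    by have [Q' [Q't aQ' rQ']] := Da r rD ra; apply: (ct _ Q't).
  have cyr : (c y == c r) = (c' y == c' r) by apply: (cc' _ QS).
  rewrite (eq_color3 cy ca cr) (@eq_color3 (c' x) (c' y) (c' a) (c' r)) -?ccx //.
  by rewrite cyr (eq_sym (c a)) (eq_sym (c' a)) cra.
move=> i j; have [ci|ci] := boolP (c i == c x).
  have c'i : c' i == c' x by rewrite -ccx.
  by rewrite (eqP ci) (eqP c'i) (eq_sym (c x)) (eq_sym (c' x)) ccx.
have [cj|cj] := boolP (c j == c x).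
  have c'j : c' j == c' x by rewrite -ccx.
  by rewrite (eqP cj) (eqP c'j) ccx.
rewrite (eq_color3 ci cj (Dcx a aD)) !cca //.
by apply/esym/(@eq_color3 (c' x)); rewrite -ccx //; apply: Dcx.
Qed.

Lemma can_force_partition_star :
  can_force k (@solved_partition n) (m + m').
Proof.
have [|S [sS SQ Scov]] := @star_cover n k m x setT kpos.
  by rewrite setTD cardsC1 card_ord.
have /choice[T hT] : forall d : coloring n, exists t : seq (query n),
    [/\ size t = m', forall Q, Q \in t -> #|Q| = k &
     exists2 D, representatives S d D &
      D = set0 \/ exists2 a, a \in D & forall r, r \in D -> r != a ->
       exists Q, [/\ Q \in t, a \in Q & r \in Q]].
  move=> d; have [D cD hD] := exists_representatives S d; rewrite sS in cD.
  by have [t [st tQ tD]] := comparison_queries cD; exists t; split=> //; exists D.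
have /choice[explain hex] : forall h, exists c : coloring n,
    (exists c, consistent c h) -> consistent c h.
  move=> h; have [[c hc]|no] := pselect (exists c, consistent c h).
    by exists c.
  by exists [ffun=> ord0].
have [Q0 cQ0] : exists Q0 : query n, #|Q0| = k.
  have [|[|Q0 s] [s1 sQ _]] := @star_cover n k 1 x set0 kpos => //.
    by rewrite set0D cards0.
  by exists Q0; case: (sQ Q0) => //; rewrite mem_head.
(* The second round is planned from the first [m] answers alone, so the plan stays the same while it
   is carried out. *)
pose L h := S ++ T (explain (take m h)).
have sL h : size (L h) = m + m'.
  by rewrite size_cat sS; case: (hT (explain (take m h))) => ->.
exists (fun h => nth Q0 (L h) (size h)) => [h|a _].
  have [lt_h|le_h] := ltnP (size h) (size (L h)); last by rewrite nth_default.
  have := mem_nth Q0 lt_h; rewrite mem_cat => /orP[/SQ[]//|].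
  by case: (hT (explain (take m h))) => _ + _; apply.
set q := fun h => _; exists (m + m') => //.
set h := play q a (m + m').
have asked Q : Q \in L h -> exists R, (Q, R) \in h.
  move=> /(nthP Q0)[i]; rewrite sL => lt_i <-.
  have eqi : play q a i = take i h by rewrite play_take // ltnW.
  (* For [i < m] the query comes from [S] and does not depend on the history; from [m] on, the first
     [m] answers are those of the final history [h]. *)
  have q_i : q (play q a i) = nth Q0 (L h) i.
    rewrite /q size_play eqi /L !nth_cat sS; case: ltnP => // le_mi.
    by rewrite take_takel.
  exists (a (play q a i) (q (play q a i))); rewrite -q_i.
  have : take i.+1 h = play q a i.+1 by rewrite play_take.
  move=> E; apply: (@mem_take i.+1); rewrite E /= mem_rcons; exact: mem_head.
have [[c hc]|no] := pselect (exists c, consistent c h); last first.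
  by exists set0 => c hc; case: no; exists c.
exists (preim_partition c setT) => c' hc'.
set d := explain (take m h).
have cons_take (b : coloring n) : consistent b h -> consistent b (take m h).
  by move=> hb qa /mem_take; apply: hb.
have hd : consistent d (take m h) by apply: hex; exists c; apply: cons_take.
have eqker (b b' : coloring n) g Q R : consistent b g -> consistent b' g ->
    (Q, R) \in g -> {in Q &, forall i j, (b i == b j) = (b' i == b' j)}.
  by move=> hb hb' QR; apply/true_answerP; rewrite -(hb _ QR) -(hb' _ QR).
have [sT Tk [D hD Dt]] := hT d.
suff E : forall i j, (c i == c j) = (c' i == c' j).
  by apply/esym/true_answerP => i j _ _; apply: E.
apply: (@star_comparison_kernel S (T d) d c c' D) => //.
- by move=> Q /SQ[].
- by move=> y yx; apply: Scov.
- move=> Q /(nthP Q0)[i]; rewrite sS => lt_i <-.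
  have eqi : play q a i = take i h by rewrite play_take // ltnW ?ltn_addr.
  have q_i : q (play q a i) = nth Q0 S i.
    by rewrite /q size_play /L nth_cat sS lt_i.
  rewrite -q_i; apply: (@eqker _ _ _ _ (a (play q a i) (q (play q a i)))).
  + exact: cons_take hc.
  + exact: hd.
  apply: (@mem_take i.+1); rewrite take_takel // play_take; last exact: ltn_addr.
  by rewrite /= mem_rcons; exact: mem_head.
- move=> Q QS; have [|R QR] := asked Q; first by rewrite mem_cat QS.
  exact: eqker QR.
move=> Q QT; have [|R QR] := asked Q; first by rewrite mem_cat QT orbT.
exact: eqker QR.
Qed.

End Upper.

(** * Lower bound: component labels of a hypergraph *)

Lemma edge_labels (T : finType) (V : {set T}) (es : seq {set T}) :
    (forall E, E \in es -> E \subset V) ->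
  exists2 f : T -> T,
    forall E, E \in es -> {in E &, forall u v, f u = f v}
    & #|V| <= #|f @: V| + \sum_(E <- es) #|E|.-1.
Proof.
elim: es => [|E es IHes] esV.
  by exists id => //; rewrite big_nil addn0 imset_id.
have [|f fE cV] := IHes; first by move=> F Fes; rewrite esV // inE Fes orbT.
have [E0|[v vE]] := set_0Vmem E.
  exists f; last by rewrite big_cons E0 cards0.
  by move=> F; rewrite inE => /predU1P[->|/fE//] u w; rewrite E0 inE.
(* Adding the edge [E] merges the labels that occur on it, at most [#|E|] of them, into one. *)
pose g u := if f u \in f @: E then f v else f u.
exists g => [F|].
  rewrite inE => /predU1P[-> u w uE wE|Fes u w uF wF]; last first.
    by rewrite /g (fE F Fes u w).
  by rewrite /g !imset_f.
have EV : E \subset V by rewrite esV ?mem_head.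
have sub : f v |: (f @: V :\: f @: E) \subset g @: V.
  rewrite subUset sub1set; apply/andP; split.
    apply/imsetP; exists v; first exact: (subsetP EV).
    by rewrite /g imset_f.
  apply/subsetP => z; rewrite inE => /andP[zE /imsetP[u uV Ez]].
  by apply/imsetP; exists u => //; rewrite /g -Ez (negPf zE).
have := subset_leq_card sub.
rewrite cardsU1 !inE imset_f //= big_cons cardsD (setIidPr (imsetS f EV)).
by have := leq_imset_card f E; have := subset_leq_card (imsetS f EV); lia.
Qed.

(** * Lower bound: tied colorings and the invariant of Adversary *)

Section Lower.
Variables (n k : nat).
Hypothesis k_ge2 : 2 <= k.

Let s := n./2.
Let e : nat := odd n.

Lemma half_eq : n = s + s + e.
Proof. by rewrite /s /e -[LHS]odd_double_half; lia. Qed.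

Definition class (c : coloring n) (j : 'I_3) : {set 'I_n} :=
  [set i | c i == j].

Definition col0 : 'I_3 := @Ordinal 3 0 isT.
Definition col1 : 'I_3 := @Ordinal 3 1 isT.
Definition col2 : 'I_3 := @Ordinal 3 2 isT.

Lemma color_neq2 (j : 'I_3) : j != col2 -> j = col0 \/ j = col1.
Proof.
by case: j => [[|[|[|]]]//?] _; [left|right]; apply: val_inj.
Qed.

Definition tie (c : coloring n) : Prop :=
  [/\ #|class c col0| = s, #|class c col1| = s & #|class c col2| = e].

Lemma card_class c (A : {set 'I_n}) :
  #|A| = #|A :&: class c col0| + #|A :&: class c col1| + #|A :&: class c col2|.
Proof.
rewrite -(cardsID (class c col0) A) -(cardsID (class c col1) (A :\: _)).
rewrite addnA; congr (_ + _ + _); apply: eq_card => i; rewrite !inE;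
by case: (c i) => [[|[|[|]]]//?]; rewrite -!val_eqE /= ?andbT ?andbF.
Qed.

Definition touched (h : history n) : {set 'I_n} := \bigcup_(qa <- h) qa.1.

Definition two_colored (c : coloring n) (Q : query n) : bool :=
  [&& Q :&: class c col0 != set0, Q :&: class c col1 != set0
    & Q :&: class c col2 == set0].

Definition mixed (c : coloring n) (h : history n) : nat :=
  count (fun qa => two_colored c qa.1) h.

(* For odd [n], as long as more than [k] balls are untouched, no query can force
   Adversary to reveal the ball of color 2. *)
Definition threshold : nat := if odd n then n - k else n.

Lemma threshold_le : threshold <= 2 * s.
Proof.
by rewrite /threshold; have := half_eq; rewrite /e; case: (odd n); lia.
Qed.

(** In the first alternative enough two-colored queries have been answered, and Adversary may keep
    [c] for the rest of the game. In the second one the touched part of colors 0 and 1 is paid for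
    by two-colored queries, each of which touches at most [k.-1] balls of either color. *)
Definition adversary_inv (h : history n) : Prop :=
  [/\ forall qa, qa \in h -> #|qa.1| = k
   & exists c, [/\ consistent c h, tie c
   & (threshold <= 2 * (mixed c h * k.-1)) \/
     (touched h :&: class c col2 = set0 /\
      forall j, j != col2 -> #|touched h :&: class c j| < s /\
        #|touched h :&: class c j| <= mixed c h * k.-1)]].

Lemma touched_rcons (h : history n) qa : touched (rcons h qa) = touched h :|: qa.1.
Proof. by rewrite /touched -cats1 big_cat big_seq1. Qed.

Lemma sub_touched (h : history n) qa : qa \in h -> qa.1 \subset touched h.
Proof. by move=> qah; rewrite /touched (big_rem qa qah) subsetUl. Qed.

Lemma mixed_rcons c (h : history n) qa :
  mixed c (rcons h qa) = mixed c h + two_colored c qa.1.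
Proof. by rewrite /mixed -cats1 count_cat /= addn0. Qed.

Definition swap (y z : 'I_n) (c : coloring n) : coloring n :=
  [ffun i => c (tperm y z i)].

Lemma tie_swap y z c : tie c -> tie (swap y z c).
Proof.
have E j : #|class (swap y z c) j| = #|class c j|.
  rewrite -(card_preimset (class c j) (@perm_inj _ (tperm y z))).
  by apply: eq_card => i; rewrite !inE ffunE.
by case=> ? ? ?; split; rewrite E.
Qed.

Lemma swap_out y z c i : i != y -> i != z -> swap y z c i = c i.
Proof. by move=> iy iz; rewrite ffunE tpermD // eq_sym. Qed.

Lemma swapL y z c : swap y z c y = c z.
Proof. by rewrite ffunE tpermL. Qed.

Lemma exists_other c (j : 'I_3) (T : {set 'I_n}) :
  #|T :&: class c j| < #|class c j| -> exists2 y, y \notin T & c y = j.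
Proof.
move=> lt; have : class c j :\: T != set0.
  by rewrite -card_gt0 cardsD setIC subn_gt0.
by case/set0Pn => y; rewrite !inE => /andP[yT /eqP cy]; exists y.
Qed.

(* Only untouched balls are swapped, so the past answers stay true. *)
Lemma recolor_query (T Q : {set 'I_n}) c :
    #|Q| = k -> tie c -> ~~ (Q \subset T) -> T :&: class c col2 = set0 ->
    (odd n -> #|T :|: Q| < n) ->
    (forall j, j != col2 -> #|T :&: class c j| < s) ->
  exists c', [/\ tie c', {in T, c' =1 c}, two_colored c' Q
     & Q :&: class c' col2 = set0].
Proof.
move=> cQ tc QT T2 oddT ltT.
(* First color 2 is moved out of [Q]: its only ball [x], present when [n] is odd, is swapped with a
   ball outside both [T] and [Q]. *)
have [c1 [tc1 c1T Q2]] : exists c1, [/\ tie c1, {in T, c1 =1 c}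
    & Q :&: class c1 col2 = set0].
  have [Q2|[x xQ2]] := set_0Vmem (Q :&: class c col2); first by exists c.
  move: xQ2; rewrite !inE => /andP[xQ /eqP cx].
  have class2 : class c col2 = [set x].
    apply/esym/eqP; rewrite eqEcard sub1set inE cx eqxx cards1.
    by case: tc => _ _ ->; rewrite /e; case: (odd n).
  have on : odd n.
    by case: tc => _ _; rewrite class2 cards1 /e; case: (odd n).
  have : ~: (T :|: Q) != set0.
    rewrite -card_gt0; have := cardsC (T :|: Q); rewrite card_ord.
    by have := oddT on; lia.
  case/set0Pn => y; rewrite !inE negb_or => /andP[yT yQ].
  have xT : x \notin T.
    by apply/negP => xT; have := in_set0 x; rewrite -T2 !inE xT cx eqxx.
  have neq_T z i : i \in T -> z \notin T -> i != z.
    by move=> iT; apply: contraNneq => <-.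
  exists (swap x y c); split; first exact: tie_swap.
    by move=> i iT; rewrite swap_out // neq_T.
  apply/setP => i; rewrite !inE; case iQ: (i \in Q) => //=.
  have iy : i != y by apply: contraNneq yQ => <-.
  have [->|ix] := eqVneq i x.
    rewrite swapL; apply/negP => cy.
    have : y \in class c col2 by rewrite inE.
    rewrite class2 inE => /eqP yx; by move: yQ; rewrite yx xQ.
  rewrite swap_out //; apply/negP => ci.
  have : i \in class c col2 by rewrite inE.
  by rewrite class2 inE (negPf ix).
have eqT j : T :&: class c1 j = T :&: class c j.
  by apply/setP => i; rewrite !inE; case iT: (i \in T) => //=; rewrite c1T.
have cl j : j != col2 -> #|class c1 j| = s.
  by case: tc1 => t0 t1 _ /color_neq2[]->.
have cQ2 i : i \in Q -> c1 i != col2.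
  move=> iQ; apply/negP => ci; have := in_set0 i.
  by rewrite -Q2 !inE iQ ci.
have [mix|mono] := boolP (two_colored c1 Q); first by exists c1.
(* Now [Q] is monochromatic. Its untouched ball [d] is swapped with an untouched ball [y] of the
   other color among 0 and 1, which lies outside [Q]; since [k >= 2], another ball [d'] of [Q] keeps
   the old color. *)
have [d dQ dT] := subsetPn QT.
pose j' := if c1 d == col0 then col1 else col0.
have j'2 : j' != col2 by rewrite /j'; case: ifP.
have monoE i : i \in Q -> c1 i = c1 d.
  move: mono; rewrite /two_colored Q2 eqxx andbT negb_and !negbK.
  have dj := cQ2 d dQ => Q01 iQ; have ij := cQ2 i iQ.
  have in01 z l : z \in Q -> Q :&: class c1 l == set0 -> c1 z != l.
    move=> zQ /eqP E; apply/negP => cz; have := in_set0 z.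
    by rewrite -E !inE zQ cz.
  case/orP: Q01 => E; move: (in01 _ _ dQ E) (in01 _ _ iQ E) dj ij;
  by case: (c1 d) (c1 i) => [[|[|[|]]]//?] [[|[|[|]]]//?] *; apply: val_inj.
have dj' : c1 d != j' by rewrite /j'; case: ifP => [/eqP->|->].
have [|y yT cy] := @exists_other c1 j' T; first by rewrite eqT cl // ltT.
have yQ : y \notin Q by apply: contraNN dj' => /monoE <-; rewrite cy.
have [d' d'Q d'd] : exists2 d', d' \in Q & d' != d.
  have : Q :\ d != set0.
    by rewrite -card_gt0; have := cardsD1 d Q; rewrite dQ; lia.
  by case/set0Pn => z; rewrite !inE => /andP[]; exists z.
have sd' : swap d y c1 d' = c1 d.
  by rewrite swap_out ?monoE //; apply: contraNneq yQ => <-.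
have sd : swap d y c1 d = j' by rewrite swapL.
exists (swap d y c1).
have S2 : Q :&: class (swap d y c1) col2 = set0.
  apply/setP => i; rewrite !inE; case iQ: (i \in Q) => //=.
  have [->|id] := eqVneq i d; first by rewrite sd (negPf j'2).
  rewrite swap_out //; first by rewrite (negPf (cQ2 i iQ)).
  by apply: contraNneq yQ => <-.
split=> //; first exact: tie_swap.
  move=> i iT; rewrite swap_out ?c1T //.
    by apply: contraNneq dT => <-.
  by apply: contraNneq yT => <-.
rewrite /two_colored S2 eqxx andbT.
have inQ z l : z \in Q -> swap d y c1 z = l ->
    Q :&: class (swap d y c1) l != set0.
  by move=> zQ zl; apply/set0Pn; exists z; rewrite !inE zQ zl eqxx.
have := cQ2 d dQ; move: sd sd'; rewrite /j'.
case: ifP => [/eqP->|/negbT c0] sd sd' c2.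
  by rewrite (inQ d') // (inQ d).
rewrite (inQ d) // (inQ d') // sd'.
by move: c0 c2; case: (c1 d) => [[|[|[|]]]//?] *; apply: val_inj.
Qed.

Lemma card_ord_interval (a b : nat) :
  b <= n -> #|[set i : 'I_n | a <= i < b]| = b - a.
Proof.
move=> bn; rewrite -sum1_card (eq_bigl (fun i : 'I_n => a <= i < b)); last first.
  by move=> i; rewrite inE.
rewrite -(big_mkord (fun i => a <= i < b) (fun=> 1)).
rewrite -[RHS]muln1 -sum_nat_const_nat [RHS](big_nat_widenl _ 0) //.
by rewrite (big_nat_widen _ _ _ _ _ bn).
Qed.

Lemma exists_tie : exists c, tie c.
Proof.
exists [ffun i : 'I_n => if i < s then col0 else
  if i < s + s then col1 else col2].
have nE := half_eq.
split.
- rewrite -[RHS]subn0 -card_ord_interval; last by lia.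
  by apply: eq_card => i; rewrite !inE ffunE /=;
  case: (ltnP i s) => ?; case: (ltnP i (s + s)) => ? //; lia.
- rewrite -[RHS](addnK s) -card_ord_interval; last by lia.
  by apply: eq_card => i; rewrite !inE ffunE /=;
  case: (ltnP i s) => ?; case: (ltnP i (s + s)) => ? //; lia.
rewrite -[RHS](addKn (s + s)) -nE -card_ord_interval //.
by apply: eq_card => i; rewrite !inE ffunE ltn_ord /=;
  case: (ltnP i s) => ?; case: (ltnP i (s + s)) => ? //; lia.
Qed.

Lemma adversary_inv0 : k <= n -> adversary_inv [::].
Proof.
move=> kn; split=> //; have [c tc] := exists_tie; exists c; split=> //.
right; rewrite /touched big_nil set0I; split=> // j _.
by rewrite set0I cards0; split=> //; have := half_eq; rewrite /e; lia.
Qed.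

Lemma eq_mixed (c c' : coloring n) (h : history n) :
  {in touched h, c' =1 c} -> mixed c' h = mixed c h.
Proof.
move=> E; apply: eq_in_count => qa qah; have /subsetP sub := sub_touched qah.
have EI j : qa.1 :&: class c' j = qa.1 :&: class c j.
  by apply/setP => i; rewrite !inE; case iq: (i \in _) => //=; rewrite E ?sub.
by rewrite /two_colored !EI.
Qed.

(** A query inside the touched set is answered by the current coloring. Any other one is made
    two-colored, so each of the colors 0 and 1 misses a ball of [Q] and gains at most [k.-1] touched
    balls. If this uses up a class, then [s] is at most [mixed * k.-1], and [threshold_le] gives the
    first alternative. *)
Lemma adversary_inv_step (h : history n) (Q : query n) :
  adversary_inv h -> #|Q| = k -> exists R, adversary_inv (rcons h (Q, R)).
Proof.
move=> [hk [c [hc tc inv]]] cQ.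
have hk' R qa : qa \in rcons h (Q, R) -> #|qa.1| = k.
  by rewrite mem_rcons inE => /predU1P[->//|/hk].
have keep : (threshold <= 2 * (mixed c h * k.-1)) ->
    exists R, adversary_inv (rcons h (Q, R)).
  move=> le; exists (true_answer c Q); split; first exact: hk'.
  exists c; split=> //; first exact/consistent_rcons.
  left; rewrite mixed_rcons; apply: leq_trans le _.
  by rewrite leq_mul2l leq_mul2r leq_addr !orbT.
case: inv => [/keep//|[T2 T01]].
have [/keep//|ltW] := leqP threshold (2 * (mixed c h * k.-1)).
have [QT|QT] := boolP (Q \subset touched h).
  exists (true_answer c Q); split; first exact: hk'.
  exists c; split=> //; first exact/consistent_rcons.
  right; rewrite touched_rcons /= (setUidPl QT); split=> // j /T01[lt le].
  split=> //; rewrite mixed_rcons; apply: leq_trans le _.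
  by rewrite leq_mul2r leq_addr orbT.
(* This is below the threshold, which for odd [n] is [n - k]; hence some ball lies outside both the
   touched set and [Q]. *)
have cT : #|touched h| <= 2 * (mixed c h * k.-1).
  rewrite (card_class c) T2 cards0 addn0.
  by have [_ +] := T01 col0 isT; have [_ +] := T01 col1 isT; lia.
have [|j /T01[]//|c' [tc' c'T mix Q2]] := recolor_query cQ tc QT T2.
  move=> on; apply: leq_ltn_trans (leq_card_setU _ _) _.
  by move: ltW; rewrite /threshold on cQ; lia.
have hc' : consistent c' h.
  apply: consistent_eqker hc _ => qa qah i j iq jq.
  by have /subsetP sub := sub_touched qah; rewrite !c'T ?sub.
have EI j : touched h :&: class c' j = touched h :&: class c j.
  by apply/setP => i; rewrite !inE; case iT: (i \in _) => //=; rewrite c'T.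
exists (true_answer c' Q); split; first exact: hk'.
exists c'; split=> //; first exact/consistent_rcons.
rewrite touched_rcons mixed_rcons (eq_mixed c'T) /= mix addn1.
have le_j j : j != col2 ->
    #|(touched h :|: Q) :&: class c' j| <= (mixed c h).+1 * k.-1.
  move=> j2; rewrite setIUl mulSn addnC EI.
  apply: leq_trans (leq_card_setU _ _) (leq_add _ _); first by case: (T01 j j2).
  rewrite -ltnS prednK; last by lia.
  rewrite -cQ; apply: proper_card; rewrite properE subsetIl /=.
  apply/negP => /subsetP sub; case/and3P: mix => /set0Pn[a] + /set0Pn[b].
  rewrite !inE => /andP[aQ /eqP ca] /andP[bQ /eqP cb] _.
  have := sub _ aQ; have := sub _ bQ; rewrite !inE ca cb.
  by move=> /andP[_ /eqP<-] /andP[].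
have [lt0|ge0] := ltnP #|(touched h :|: Q) :&: class c' col0| s; last first.
  left; have := leq_trans ge0 (le_j col0 isT).
  by have := threshold_le; lia.
have [lt1|ge1] := ltnP #|(touched h :|: Q) :&: class c' col1| s; last first.
  left; have := leq_trans ge1 (le_j col1 isT).
  by have := threshold_le; lia.
right; split; first by rewrite setIUl EI T2 Q2 setU0.
move=> j j2; split; last exact: le_j.
by case/color_neq2: j2 => ->.
Qed.

(** * Lower bound: solved positions without a plurality *)

Lemma color_cases (j j' d : 'I_3) :
  j != col2 -> j' != col2 -> j != j' -> [\/ d = j, d = j' | d = col2].
Proof.
move=> /color_neq2[]-> /color_neq2[]->; rewrite ?eqxx // => _;
have [->|/color_neq2[]->] := eqVneq d col2;
by [constructor 1 | constructor 2 | constructor 3].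
Qed.

Lemma plurality_class c j :
  (forall d, d != j -> #|class c d| < #|class c j|) ->
  exists b, plurality_ball c b.
Proof.
move=> lt; have [d dj] : exists d : 'I_3, d != j.
  by have [->|j0] := eqVneq j col0; [exists col1 | exists col0; rewrite eq_sym].
have /card_gt0P[b] : 0 < #|class c j| by apply: leq_ltn_trans (lt d dj).
by rewrite inE => /eqP cb; exists b => d'; rewrite cb; apply: lt.
Qed.

Hypothesis k_le_n : k <= n.

Let s_gt0 : 0 < s.
Proof. by have := half_eq; rewrite /e; lia. Qed.

Let e_le1 : e <= 1.
Proof. by rewrite /e; case: (odd n). Qed.

Lemma tie_no_plurality c : tie c -> ~ exists b, plurality_ball c b.
Proof.
move=> [c0 c1 c2] [b hb].
have [cb|/color_neq2[cb|cb]] := eqVneq (c b) col2.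
- by have := hb col0; rewrite cb -!/(class _ _) c0 c2 => /(_ isT); lia.
- by have := hb col1; rewrite cb -!/(class _ _) c0 c1 => /(_ isT); lia.
by have := hb col0; rewrite cb -!/(class _ _) c0 c1 => /(_ isT); lia.
Qed.

Lemma card_tie c j : tie c -> j != col2 -> #|class c j| = s.
Proof. by case=> t0 t1 _ /color_neq2[]->. Qed.

Section Solved.
Variables (h : history n) (c : coloring n).
Hypotheses (tc : tie c) (hc : consistent c h).
Hypothesis no_plurality :
  forall c', consistent c' h -> ~ exists b, plurality_ball c' b.

(** Otherwise an untouched ball of color 0 could be recolored 1, and color 1 would win with [s + 1]
    balls. This excludes the second alternative of [adversary_inv] once the game is solved. *)
Lemma col0_touched :
  touched h :&: class c col2 = set0 -> s <= #|touched h :&: class c col0|.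
Proof.
move=> T2; rewrite leqNgt; apply/negP => lt.
have [t0 t1 t2] := tc.
have [|y yT cy] := @exists_other c col0 (touched h); first by rewrite t0.
pose c' : coloring n := [ffun i => if i == y then col1 else c i].
have hc' : consistent c' h.
  apply: consistent_eqker hc _ => qa qah i j iq jq.
  have /subsetP sub := sub_touched qah.
  have ne z : z \in qa.1 -> z == y = false.
    by move=> zq; apply/negbTE; apply: contraNneq yT => <-; apply: sub.
  by rewrite !ffunE !ne.
apply: (no_plurality hc'); apply: (@plurality_class _ col1) => d d1.
have -> : class c' col1 = y |: class c col1.
  by apply/setP => i; rewrite !inE ffunE; case: ifP.
rewrite cardsU1 inE cy t1 /=.
have : class c' d \subset class c d.
  apply/subsetP => i; rewrite !inE ffunE; case: ifP => // _.
  by rewrite eq_sym (negPf d1).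
move=> /subset_leq_card /leq_ltn_trans; apply.
by have [->|d2] := eqVneq d col2; rewrite ?t2 ?(card_tie tc) //; lia.
Qed.

(** Giving [C] color 2 changes no answer and leaves classes of sizes [s - #|C|], [s] and [#|C| + e].
    Either the untouched class [j'] or color 2 is then a strict winner, unless their sizes agree. *)
Lemma card_closed (j : 'I_3) (C : {set 'I_n}) :
    j != col2 -> C \subset class c j -> C != set0 ->
    (forall qa, qa \in h -> forall u v, u \in qa.1 -> v \in qa.1 ->
       c v \in [:: j; col2] -> u \in C -> v \in C) ->
  #|C| + e = s.
Proof.
move=> j2 /subsetP sC C0 clC.
pose j' := if j == col0 then col1 else col0.
have j'2 : j' != col2 by rewrite /j'; case: ifP.
have jj' : j != j' by rewrite /j'; case: ifP => [/eqP->|->].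
pose c' : coloring n := [ffun i => if i \in C then col2 else c i].
have cC i : i \in C -> c i = j by move=> /sC; rewrite inE => /eqP.
have hc' : consistent c' h.
  apply: consistent_eqker hc _ => qa qah.
  have sep u v : u \in qa.1 -> v \in qa.1 -> u \in C -> v \notin C ->
      (c u == c v) = false /\ (col2 == c v) = false.
    move=> uq vq uC vC; have := clC qa qah u v uq vq.
    rewrite uC (negPf vC) (cC u uC) !inE ![_ == c v]eq_sym.
    by case: eqP => //= _; case: eqP => //= _ /(_ isT isT).
  move=> u v uq vq; rewrite !ffunE; case: ifPn => uC; case: ifPn => vC //.
  - by rewrite (cC u) // (cC v) // !eqxx.
  - by have [-> ->] := sep u v uq vq uC vC.
  by rewrite (eq_sym (c u) (c v)) (eq_sym (c u) col2);
    have [-> ->] := sep v u vq uq vC uC.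
have [t0 t1 t2] := tc; have tj := card_tie tc j2; have tj' := card_tie tc j'2.
have cl : class c' j = class c j :\: C.
  apply/setP => i; rewrite !inE ffunE; case: ifP => //= _.
  by rewrite eq_sym (negPf j2).
have cl' : class c' j' = class c j'.
  apply/setP => i; rewrite !inE ffunE; case: ifP => //= iC.
  by rewrite (cC i iC) eq_sym (negPf j'2) (negPf jj').
have cl2 : class c' col2 = C :|: class c col2.
  by apply/setP => i; rewrite !inE ffunE; case: ifP.
have C_gt0 : 0 < #|C| by rewrite card_gt0.
have leC : #|C| <= s by rewrite -tj; apply/subset_leq_card/subsetP.
have cardj : #|class c' j| < s.
  rewrite cl cardsD tj (setIidPr _); last exact/subsetP.
  by lia.
have card2 : #|class c' col2| = #|C| + e.
  rewrite cl2 cardsU t2 (_ : _ :&: _ = set0) ?cards0 ?subn0 //.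
  apply/setP => i; rewrite !inE; case iC: (i \in C) => //=.
  by rewrite (cC i iC); apply/negbTE.
have [lt|gt|//] := ltngtP (#|C| + e) s; case: (no_plurality hc').
- apply: (@plurality_class _ j') => d; rewrite cl' tj'.
  by case: (color_cases d j2 j'2 jj') => ->; rewrite ?card2 ?eqxx.
apply: (@plurality_class _ col2) => d; rewrite card2.
case: (color_cases d j2 j'2 jj') => ->; rewrite ?eqxx // => _.
  exact: ltn_trans gt.
by rewrite cl' tj'.
Qed.

Lemma rank_bound (j : 'I_3) : j != col2 ->
  s <= 1 + \sum_(qa <- h) #|qa.1 :&: (class c j :|: class c col2)|.-1.
Proof.
move=> j2; set V := class c j :|: class c col2.
have [t0 t1 t2] := tc; have tj := card_tie tc j2.
have cV : #|V| = s + e.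
  rewrite cardsU tj t2 (_ : _ :&: _ = set0) ?cards0 ?subn0 //.
  apply/setP => i; rewrite !inE; case: eqP => //= ->; exact/negbTE.
have [|f fE] := @edge_labels _ V [seq qa.1 :&: V | qa <- h].
  by move=> E /mapP[qa _ ->]; apply: subsetIr.
rewrite big_map cV => le.
(* [F] keeps the labels that avoid color 2; at most [e] labels are dropped. The preimage of any
   nonempty part of [F] is closed in the sense of [card_closed]. *)
set F := f @: V :\: f @: class c col2.
have cF : #|f @: V| <= #|F| + e.
  rewrite -(cardsID (f @: class c col2) (f @: V)) addnC leq_add2l.
  apply: leq_trans (subset_leq_card (subsetIr _ _)) _.
  by rewrite -t2 leq_imset_card.
suff F1 : #|F| <= 1.
  rewrite -(leq_add2r e) addnAC; apply: leq_trans le _.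
  by rewrite leq_add2r (leq_trans cF) // leq_add2r.
pose C (G : {set 'I_n}) := [set u in V | f u \in G].
have cardC (G : {set 'I_n}) : G \subset F -> G != set0 -> #|C G| + e = s.
  move=> /subsetP GF /set0Pn[r rG].
  apply: (@card_closed j) => //.
  - apply/subsetP => u; rewrite inE => /andP[uV uG].
    have := GF _ uG; rewrite inE => /andP[u2 _].
    move: uV; rewrite !inE; case: (c u == j) => //= cu.
    by case/negP: u2; apply: imset_f; rewrite inE.
  - have := GF _ rG; rewrite inE => /andP[_ /imsetP[u uV ru]].
    by apply/set0Pn; exists u; rewrite inE uV -ru.
  move=> qa qah u v uq vq cv; rewrite inE => /andP[uV uG].
  have vV : v \in V by move: cv; rewrite !inE.
  rewrite inE vV /= -(fE _ (map_f _ qah) u v) // inE ?uq ?vq //.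
(* Two distinct labels would give closed sets, one strictly inside the other, both of size
   [s - e]. *)
apply/card_le1_eqP => r r' rF r'F; apply/eqP; apply: contraT => rr'.
have cr : #|C [set r]| + e = s.
  by apply: cardC; rewrite ?sub1set // -card_gt0 cards1.
have crr' : #|C [set r; r']| + e = s.
  apply: cardC; first by rewrite subUset !sub1set rF.
  by apply/set0Pn; exists r; rewrite !inE eqxx.
have : C [set r] \proper C [set r; r'].
  apply/properP; split.
    by apply/subsetP => u; rewrite !inE => /andP[->] ->.
  have := r'F; rewrite inE => /andP[_ /imsetP[u uV ru]].
  by exists u; rewrite inE uV -ru ?set22 // inE.
by move/proper_card; rewrite -(ltn_add2r e) cr crr' ltnn.
Qed.

End Solved.

(** * Lower bound: summing over the queries *)

Lemma sum_two_count (T : eqType) (r : seq T) (f g : T -> nat) (p : pred T) m :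
  (forall x, x \in r -> f x + g x + p x <= m) ->
  \sum_(x <- r) f x + \sum_(x <- r) g x + count p r <= size r * m.
Proof.
elim: r => [|x r IHr] le; first by rewrite !big_nil.
have := le x (mem_head _ _); have : forall y, y \in r -> f y + g y + p y <= m.
  by move=> y yr; apply: le; rewrite inE yr orbT.
move=> /IHr le_r le_x; rewrite !big_cons /= mulSn.
rewrite [X in X + _ <= _]addnACA addnACA.
exact: leq_add.
Qed.

(** Let [z <= 1] be the number of balls of color 2 in [Q]. If both traces are nonempty, they
    contribute [k + z - 2], and a two-colored query has [z = 0]. If one is empty, the other is all
    of [Q] and [Q] is not two-colored. *)
Lemma query_rank_bound c (Q : query n) : tie c -> #|Q| = k ->
  #|Q :&: (class c col0 :|: class c col2)|.-1
  + #|Q :&: (class c col1 :|: class c col2)|.-1 + two_colored c Q <= k.-1.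
Proof.
move=> [_ _ t2] cQ.
have := (leq_card_setU (Q :&: class c col0) (Q :&: class c col2)).1.
have := (leq_card_setU (Q :&: class c col1) (Q :&: class c col2)).1.
rewrite -!setIUr; have := card_class c Q.
have : #|Q :&: class c col2| <= 1.
  by apply: leq_trans e_le1; rewrite -t2 subset_leq_card ?subsetIr.
rewrite /two_colored -!cards_eq0 cQ.
move: #|_ :&: _| #|_ :&: _| #|_ :&: _| #|_ :&: _| #|_ :&: _| => a b u z v.
by case: eqP; case: eqP; case: eqP => /=; lia.
Qed.

Lemma solved_size_bound (h : history n) :
    adversary_inv h -> solved_plurality h ->
  exists2 N, threshold <= 2 * (N * k.-1)
    & 2 * s + N <= size h * k.-1 + 2.
Proof.
move=> [hk [c [hc tc inv]]] solved.
(* The tie [c] is consistent and has no plurality ball, so Questioner can only have stopped by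
   declaring that there is none. *)
have nop c' : consistent c' h -> ~ exists b, plurality_ball c' b.
  case: solved => [[b hb]|]; last exact.
  by case: (tie_no_plurality tc); exists b; apply: hb.
exists (mixed c h).
  case: inv => // -[T2 T01]; have [] := T01 col0 isT.
  by rewrite ltnNge (col0_touched tc hc nop T2).
have := leq_add (rank_bound tc hc nop (isT : col0 != col2))
  (rank_bound tc hc nop (isT : col1 != col2)).
rewrite addnACA -(leq_add2r (mixed c h)) -[leqRHS]addnA => /leq_trans le.
rewrite mul2n -addnn [leqRHS]addnC; apply: le; rewrite leq_add2l.
exact: (@sum_two_count _ h _ _ (fun qa => two_colored c qa.1) k.-1
  (fun qa qah => query_rank_bound tc (hk qa qah))).
Qed.

End Lower.

(** * Passage to rational bounds and the theorem *)

Import Order.TTheory GRing.Theory Num.Theory.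
Local Open Scope ring_scope.

(** Used with [K = k - 1], [q] the number of queries, [N] the number of two-colored ones and [b] the
    threshold; eliminating [N] leaves the stated lower bounds. *)
Lemma rat_size_bound (K a b q N : rat) :
  0 < K -> b <= 2 * (N * K) -> a + N <= q * K -> a / K + b / (2 * K ^+ 2) <= q.
Proof.
move=> K0 hb ha.
have -> : a / K + b / (2 * K ^+ 2) = (2 * K * a + b) / (2 * K ^+ 2).
  by field; rewrite gt_eqF.
rewrite ler_pdivrMr ?mulr_gt0 ?exprn_gt0 //.
apply: le_trans (_ : 2 * K * (a + N) <= _); first by lra.
by rewrite [leRHS](_ : _ = 2 * K * (q * K)); [rewrite ler_pM2l ?mulr_gt0|ring].
Qed.

Lemma natr_pred (R : pzRingType) (k : nat) :
  (0 < k)%N -> k%:R - 1 = k.-1%:R :> R.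
Proof. by case: k => // k _; rewrite -natr1 addrK. Qed.

Theorem theorem1 (n k : nat) (hk : (2 <= k)%N) (hn : (k <= n)%N) :
  (~~ odd n ->
    [/\ (n%:R - 2) / (k%:R - 1) + n%:R / (2 * (k%:R - 1) ^+ 2)
          <= (A_p n k)%:R :> rat,
        (A_p n k <= A_c n k)%N
      & (A_c n k)%:Z <= Num.ceil ((n%:R - 1) / (k%:R - 1) : rat)
                        + Num.ceil ((n%:R - 1) / (k%:R - 1) ^+ 2 : rat)]) /\
  (odd n ->
    [/\ (n%:R - 5) / (k%:R - 1) + (n%:R - k%:R) / (2 * (k%:R - 1) ^+ 2)
          <= (A_p n k)%:R :> rat,
        (A_p n k <= A_c n k)%N
      & (A_c n k)%:Z <= Num.ceil ((n%:R - 1) / (k%:R - 1) : rat)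
                        + Num.ceil ((n%:R - 1) / (k%:R - 1) ^+ 2 : rat)]).
Proof.
have K0 : 0 < k.-1%:R :> rat by rewrite ltr0n -subn1 subn_gt0.
have k_gt0 : (0 < k)%N := ltnW hk.
have kE := natr_pred rat k_gt0.
have nE := natr_pred rat (leq_trans k_gt0 hn).
have [p hp] := can_force_plurality hk hn.
have [r hr] := can_force_partition hk hn.
have le_pc : (A_p n k <= A_c n k)%N.
  apply: game_value_le; have [q lq hq] := game_value_can_force hr.
  exists q => // a la; have [j lj sj] := hq a la.
  by exists j => //; apply: solved_partition_plurality.
have upper : (A_c n k)%:Z <= Num.ceil ((n%:R - 1) / (k%:R - 1) : rat)
                        + Num.ceil ((n%:R - 1) / (k%:R - 1) ^+ 2 : rat).
  rewrite kE nE.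
  have ceil_nat (y : rat) : 0 <= y -> exists m : nat, Num.ceil y = m%:Z.
    by move=> y0; exists `|Num.ceil y|%N; rewrite gez0_abs // ceil_ge0; lra.
  have [|m mE] := ceil_nat (n.-1%:R / k.-1%:R); first by rewrite divr_ge0.
  have [|m' m'E] := ceil_nat (n.-1%:R / k.-1%:R ^+ 2).
    by rewrite divr_ge0 ?exprn_ge0.
  rewrite mE m'E -PoszD lez_nat; apply: game_value_le.
  apply: can_force_partition_star => //.
  - exact: Ordinal (leq_trans k_gt0 hn).
  - rewrite -(ler_nat rat) natrM -ler_pdivrMr //.
    by have := ceil_ge (n.-1%:R / k.-1%:R : rat); rewrite mE.
  (* The integer [m' * k.-1] is at least [(n - 1) / (k - 1)], hence at least its ceiling [m]. *)
  rewrite -lez_nat -mE ceil_le_int ler_pdivrMr //.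
  have := ceil_ge (n.-1%:R / k.-1%:R ^+ 2 : rat).
  rewrite m'E ler_pdivrMr ?exprn_gt0 // => /le_trans; apply.
  by rewrite -!pmulrn natrM expr2 mulrA.
have [h [hi hs hle]] := can_force_inv (adversary_inv0 hk hn)
  (adversary_inv_step hk) (fun h hi => let: conj _ (ex_intro c hc) := hi in
    ex_intro _ c (let: And3 hc _ _ := hc in hc)) (game_value_can_force hp).
have [N hN hsz] := solved_size_bound hk hn hi hs.
have n2 := odd_double_half n.
have {hle}hsz : (2 * n./2 + N <= A_p n k * k.-1 + 2)%N.
  by apply: leq_trans hsz _; rewrite leq_add2r leq_mul2r hle orbT.
split=> on; split=> //; rewrite !kE; apply: (@rat_size_bound _ _ _ _ N%:R) => //.
- move: hN; rewrite /threshold (negPf on) -(ler_nat rat) !natrM; lra.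
- have : (n + N <= A_p n k * k.-1 + 2)%N by lia.
  by rewrite -(ler_nat rat) !natrD natrM; lra.
- move: hN; rewrite /threshold on -(ler_nat rat) !natrM natrB //; lra.
(* For odd [n], [2 * n./2 = n - 1] turns the constant 2 into 3. *)
have : (n + N <= A_p n k * k.-1 + 3)%N by lia.
by rewrite -(ler_nat rat) !natrD natrM; lra.
Qed.
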